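(* Let $N\ge M\ge 1$, let $\beta$, $a$, $dq_0$ be as in the context, where $dq_0$ satisfies condition (B) and $$\int_{|z|<1}|z|^{\gamma}\,dq_0(z)+\int_{|z|\ge 1}|z|^{\gamma-1}\,dq_0(z)<\infty$$ with $\gamma=2$ in case (I) and $\gamma=1$ in case (II). Let $f_0:\mathbb{R}^N\to\mathbb{R}$ be $\mathbb{Z}^N$-periodic with $|f_0(y)-f_0(y')|\le L|y-y'|^{\theta_2}$ for some $L>0$, $\theta_2\in(0,1]$. For $\lambda>0$ let $v_\lambda$ be the periodic viscosity solution of (I) $\;\lambda v_\lambda(y)-a(y)\int_{\mathbb{R}^M}[v_\lambda(y+\beta(z))-v_\lambda(y)-\langle\nabla v_\lambda(y),\beta(z)\rangle]\,dq_0(z)-f_0(y)=0$ in $\mathbb{T}^N$ (resp. (II) $\;\lambda v_\lambda(y)-a(y)\int_{\mathbb{R}^M}[v_\lambda(y+\beta(z))-v_\lambda(y)]\,dq_0(z)-f_0(y)=0$ in $\mathbb{T}^N$). Then there exists a unique real number $d$ such that $\lim_{\lambda\to 0}\lambda v_\lambda(y)=d$ uniformly on $\mathbb{T}^N$. Moreover $d$ is characterized by the property: for every $\delta>0$ there exist a periodic viscosity subsolution $v_\delta$ of $d-a(y)\int_{\mathbb{R}^M}[v(y+\beta(z))-v(y)-\langle\nabla v(y),\beta(z)\rangle]\,dq_0(z)-f_0(y)\le\delta$ in $\mathbb{T}^N$ and a periodic viscosity supersolution $v^\delta$ of $d-a(y)\int_{\mathbb{R}^M}[v(y+\beta(z))-v(y)-\langle\nabla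 v(y),\beta(z)\rangle]\,dq_0(z)-f_0(y)\ge-\delta$ in $\mathbb{T}^N$ (resp. the same two inequalities with the term $\langle\nabla v(y),\beta(z)\rangle$ removed in case (II)).
   Context: $\mathbb{T}^N=[0,1]^N$; functions on $\mathbb{T}^N$ are $\mathbb{Z}^N$-periodic functions on $\mathbb{R}^N$. $\beta:\mathbb{R}^M\to\mathbb{R}^N$ is continuous with $\beta(cz)=c\beta(z)$ for $c>0$ and $|\beta(z)|\le B_1|z|$. $a$ is continuous, $\mathbb{Z}^N$-periodic, $a\ge a_0>0$, $|a(y)-a(y')|\le L|y-y'|^{\theta_1}$, $\theta_1\in(0,1]$. $dq_0$ is a positive Radon measure on $\mathbb{R}^M$. Condition (B): with $S_0=\mathrm{supp}(dq_0)$, for any $y,y'\in\mathbb{T}^N$ there exist points $y_1=y,\dots,y_m=y'$ in $\mathbb{T}^N$ such that for any $\varepsilon_i>0$ there exist $J_i\subset S_0$ ($1\le i\le m-1$) with $y_i+\beta(z)\in B_{\varepsilon_i}(y_{i+1})$ (mod $\mathbb{Z}^N$) for all $z\in J_i$ and $\int_{J_i}dq_0>0$. Viscosity notions: for an equation or inequality of the form $G(y,u(y))-a(y)\int_{\mathbb{R}^M}[u(y+\beta(z))-u(y)-\langle\nabla u(y),\beta(z)\rangle]\,dq_0(z)\;\{\le c,\ \ge c,\ =c\}$ with $G$ continuous, an upper semicontinuous periodic $u$ is a subsolution (of ''$\le c$'') if for every $\hat y$ and $\phi\in C^2$ with $u-\phi$ attaining a global maximum at $\hat y$, $u(\hat y)=\phi(\hat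 y)$, the integrand with $\nabla u(\hat y)$ replaced by $\nabla\phi(\hat y)$ is $dq_0$-integrable and the inequality $\le c$ holds at $\hat y$ with this replacement; a lower semicontinuous periodic $u$ is a supersolution (of ''$\ge c$'') if the same holds with ''global minimum'' and ''$\ge c$''; a solution is a continuous function that is both. In case (II) the gradient term is absent. *)

(* Defs.v *)
From HB Require Import structures.
From mathcomp Require Import all_boot all_order all_algebra.
From mathcomp Require Import all_classical all_reals all_analysis.
Set Implicit Arguments. Unset Strict Implicit. Unset Printing Implicit Defensive.
Import Order.TTheory GRing.Theory Num.Theory.
Import numFieldNormedType.Exports.
Local Open Scope classical_set_scope.
Local Open Scope ring_scope.

Definition enorm (R : realType) (n : nat) (v : 'rV[R]_n) : R :=
  Num.sqrt (\sum_(i < n) v 0 i ^+ 2).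

Definition edot (R : realType) (n : nat) (v w : 'rV[R]_n) : R :=
  \sum_(i < n) v 0 i * w 0 i.

Definition intvec (R : realType) (n : nat) (k : 'rV[int]_n) : 'rV[R]_n :=
  map_mx (fun z : int => z%:~R) k.

Definition inT (R : realType) (n : nat) (y : 'rV[R]_n) : Prop :=
  forall i, 0 <= y 0 i <= 1.

Definition zperiodic (R : realType) (n : nat) (T : Type) (u : 'rV[R]_n -> T) :=
  forall (y : 'rV[R]_n) (k : 'rV[int]_n), u (y + intvec R k) = u y.

Definition usc (R : realType) (n : nat) (u : 'rV[R]_n -> R) :=
  forall y (e : R), 0 < e -> \forall x \near y, u x < u y + e.

Definition lsc (R : realType) (n : nat) (u : 'rV[R]_n -> R) :=
  forall y (e : R), 0 < e -> \forall x \near y, u y - e < u x.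

Definition borelRV (R : realType) (m : nat) :=
  g_sigma_algebraType (@open 'rV[R]_m).

Definition radon (R : realType) (m : nat)
  (mu : {measure set (borelRV R m) -> \bar R}) : Prop :=
  forall K : set 'rV[R]_m, compact K -> (mu K < +oo)%E.

Definition msupp (R : realType) (m : nat)
  (mu : {measure set (borelRV R m) -> \bar R}) : set 'rV[R]_m :=
  [set z | forall U : set 'rV[R]_m, open U -> U z -> (0 < mu U)%E].

Definition pderiv (R : realType) (n : nat) (i : 'I_n) (f : 'rV[R]_n -> R)
  : 'rV[R]_n -> R := fun x => 'D_(delta_mx 0 i) f x.

Definition gradv (R : realType) (n : nat) (f : 'rV[R]_n -> R) (y : 'rV[R]_n)
  : 'rV[R]_n := \row_i pderiv i f y.

Definition C2 (R : realType) (n : nat) (f : 'rV[R]_n -> R) : Prop :=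
  [/\ continuous f,
      forall i x, derivable f x (delta_mx 0 i),
      forall i, continuous (pderiv i f),
      forall i j x, derivable (pderiv i f) x (delta_mx 0 j)
    & forall i j, continuous (pderiv j (pderiv i f))].

(* the integrand of the nonlocal operator at y, gradient of u replaced by
   that of the test function phi; [withgrad = true] is case (I),
   [withgrad = false] is case (II) (no gradient term). *)
Definition integrand (R : realType) (n m : nat) (withgrad : bool)
  (beta : 'rV[R]_m -> 'rV[R]_n) (u phi : 'rV[R]_n -> R) (y : 'rV[R]_n)
  (z : 'rV[R]_m) : R :=
  u (y + beta z) - u y - (if withgrad then edot (gradv phi y) (beta z) else 0).

Definition vsub (R : realType) (n m : nat) (withgrad : bool)
  (mu : {measure set (borelRV R m) -> \bar R})
  (beta : 'rV[R]_m -> 'rV[R]_n) (a : 'rV[R]_n -> R)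
  (G : 'rV[R]_n -> R -> R) (c : R) (u : 'rV[R]_n -> R) : Prop :=
  usc u /\ zperiodic u /\
  forall (yh : 'rV[R]_n) (phi : 'rV[R]_n -> R), C2 phi ->
    (forall y, u y - phi y <= u yh - phi yh) -> u yh = phi yh ->
    mu.-integrable setT (fun z => (integrand withgrad beta u phi yh z)%:E) /\
    G yh (u yh) - a yh * fine (\int[mu]_z (integrand withgrad beta u phi yh z)%:E)
      <= c.

Definition vsuper (R : realType) (n m : nat) (withgrad : bool)
  (mu : {measure set (borelRV R m) -> \bar R})
  (beta : 'rV[R]_m -> 'rV[R]_n) (a : 'rV[R]_n -> R)
  (G : 'rV[R]_n -> R -> R) (c : R) (u : 'rV[R]_n -> R) : Prop :=
  lsc u /\ zperiodic u /\
  forall (yh : 'rV[R]_n) (phi : 'rV[R]_n -> R), C2 phi ->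
    (forall y, u yh - phi yh <= u y - phi y) -> u yh = phi yh ->
    mu.-integrable setT (fun z => (integrand withgrad beta u phi yh z)%:E) /\
    c <= G yh (u yh) - a yh * fine (\int[mu]_z (integrand withgrad beta u phi yh z)%:E).

Definition vsol (R : realType) (n m : nat) (withgrad : bool)
  (mu : {measure set (borelRV R m) -> \bar R})
  (beta : 'rV[R]_m -> 'rV[R]_n) (a : 'rV[R]_n -> R)
  (G : 'rV[R]_n -> R -> R) (c : R) (u : 'rV[R]_n -> R) : Prop :=
  continuous u /\ vsub withgrad mu beta a G c u /\ vsuper withgrad mu beta a G c u.

Definition condB (R : realType) (n m : nat)
  (mu : {measure set (borelRV R m) -> \bar R})
  (beta : 'rV[R]_m -> 'rV[R]_n) : Prop :=
  forall y y' : 'rV[R]_n, inT y -> inT y' ->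
  exists (k : nat) (pts : nat -> 'rV[R]_n),
    [/\ (1 <= k)%N, pts 0%N = y, pts k.-1 = y',
        (forall i, (i < k)%N -> inT (pts i))
      & forall i, (i < k.-1)%N -> forall eps : R, 0 < eps ->
          exists J : set (borelRV R m),
            [/\ measurable J, J `<=` msupp mu, (0 < mu J)%E
              & forall z, J z -> exists kz : 'rV[int]_n,
                  enorm (pts i + beta z - pts i.+1 - intvec R kz) < eps]].

Definition moment_cond (R : realType) (m : nat) (gam : nat)
  (mu : {measure set (borelRV R m) -> \bar R}) : Prop :=
  (\int[mu]_(z in [set z : borelRV R m | (enorm z < 1)%R]) ((enorm z ^+ gam)%R)%:E
   + \int[mu]_(z in [set z : borelRV R m | (1 <= enorm z)%R]) ((enorm z ^+ gam.-1)%R)%:E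
   < +oo)%E.

Definition ergodic_prop (R : realType) (n m : nat) (withgrad : bool)
  (mu : {measure set (borelRV R m) -> \bar R})
  (beta : 'rV[R]_m -> 'rV[R]_n) (a f0 : 'rV[R]_n -> R) (d : R) : Prop :=
  forall delta : R, 0 < delta ->
    (exists u, vsub withgrad mu beta a (fun y _ => d - f0 y) delta u) /\
    (exists u, vsuper withgrad mu beta a (fun y _ => d - f0 y) (- delta) u).

(* Main.v *)
Require Import Defs.
From HB Require Import structures.
From mathcomp Require Import all_boot all_order all_algebra.
From mathcomp Require Import all_classical all_reals all_analysis.
From mathcomp Require Import measurable_realfun ring lra.
Import Order.TTheory GRing.Theory Num.Theory.
Import numFieldNormedType.Exports.
Local Open Scope classical_set_scope.
Local Open Scope ring_scope.

(** Doubling the variables with the penalization [K |x - y|^2] gives, without any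
second order analysis, the comparison of the nonlocal terms of a sub- and a
supersolution.  After division by [a] the equation depends on [y] only through
[1 / a] and [f0 / a], so this comparison yields
- a modulus of continuity of [lam v_lam] independent of [lam];
- [min (lam v_lam) <= max (lam' v_lam')] for all [lam] and [lam'];
- the uniqueness of [d] among the numbers admitting approximate correctors.

The oscillation of [lam v_lam] tends to [0] by a strong maximum principle: if
[lam v_lam] is almost maximal at [y], a paraboloid touching it from above near
[y] shows that it is almost maximal wherever a set of positive mass jumps from
[y], hence along every chain of condition (B); equicontinuity and compactness
make this uniform.  Then [d] is the supremum of the minima of [lam v_lam], and
[v_lam] itself is an approximate corrector. *)

(** * Euclidean inner product and norm on row vectors *)

Lemma edotC {R : realType} {n} (v w : 'rV[R]_n) : edot v w = edot w v.
Proof. by apply: eq_bigr => i _; rewrite mulrC. Qed.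

Lemma edotDl {R : realType} {n} (u v w : 'rV[R]_n) :
  edot (u + v) w = edot u w + edot v w.
Proof. by rewrite -big_split; apply: eq_bigr => i _; rewrite mxE mulrDl. Qed.

Lemma edotDr {R : realType} {n} (u v w : 'rV[R]_n) :
  edot u (v + w) = edot u v + edot u w.
Proof. by rewrite edotC edotDl !(edotC u). Qed.

Lemma edotZl {R : realType} {n} (c : R) (v w : 'rV[R]_n) :
  edot (c *: v) w = c * edot v w.
Proof. by rewrite /edot mulr_sumr; apply: eq_bigr => i _; rewrite mxE mulrA. Qed.

Lemma edotZr {R : realType} {n} (c : R) (v w : 'rV[R]_n) :
  edot v (c *: w) = c * edot v w.
Proof. by rewrite edotC edotZl edotC. Qed.

Lemma edotNN {R : realType} {n} (v : 'rV[R]_n) : edot (- v) (- v) = edot v v.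
Proof. by apply: eq_bigr => i _; rewrite mxE mulrNN. Qed.

Lemma edot_delta {R : realType} {n} (v : 'rV[R]_n) i :
  edot v (delta_mx 0 i) = v 0 i.
Proof.
rewrite /edot (bigD1 i) //= big1 ?addr0; last first.
  by move=> j ji; rewrite mxE (negbTE ji) andbF mulr0.
by rewrite mxE !eqxx mulr1.
Qed.

Lemma edot_ge0 {R : realType} {n} (v : 'rV[R]_n) : 0 <= edot v v.
Proof. by apply: sumr_ge0 => i _; rewrite -expr2 sqr_ge0. Qed.

Lemma enorm_ge0 {R : realType} {n} (v : 'rV[R]_n) : 0 <= enorm v.
Proof. exact: sqrtr_ge0. Qed.

Lemma sqr_enorm {R : realType} {n} (v : 'rV[R]_n) : enorm v ^+ 2 = edot v v.
Proof.
rewrite sqr_sqrtr; last by apply: sumr_ge0 => i _; rewrite sqr_ge0.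
by apply: eq_bigr => i _; rewrite expr2.
Qed.

Lemma enorm0 {R : realType} n : enorm (0 : 'rV[R]_n) = 0.
Proof.
by apply/eqP; rewrite -sqrf_eq0 sqr_enorm /edot big1 // => i _; rewrite mxE mul0r.
Qed.

Lemma enormN {R : realType} {n} (v : 'rV[R]_n) : enorm (- v) = enorm v.
Proof. by rewrite /enorm; congr Num.sqrt; apply: eq_bigr => i _; rewrite mxE sqrrN. Qed.

Lemma enormB {R : realType} {n} (v w : 'rV[R]_n) : enorm (v - w) = enorm (w - v).
Proof. by rewrite -enormN opprB. Qed.

Lemma coord_le_enorm {R : realType} {n} (v : 'rV[R]_n) i : `|v 0 i| <= enorm v.
Proof.
rewrite -(@ler_pXn2r _ 2) ?nnegrE ?enorm_ge0 // sqr_enorm real_normK ?num_real //.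
rewrite /edot (bigD1 i) //= -expr2 lerDl.
by apply: sumr_ge0 => j _; rewrite -expr2 sqr_ge0.
Qed.

Lemma cauchy_schwarz_edot {R : realType} {n} (v w : 'rV[R]_n) :
  edot v w <= enorm v * enorm w.
Proof.
(* The squared norm of |w| v - |v| w equals 2 |v| |w| (|v| |w| - v.w). Dividing by |v| |w| leaves
   only the cases where a vector vanishes. *)
have P : 0 <= enorm v *+ 2 * enorm w * (enorm v * enorm w - edot v w).
  have := edot_ge0 (enorm w *: v + (- enorm v) *: w).
  rewrite edotDl !edotDr !edotZl !edotZr -!sqr_enorm (edotC w v) => H.
  by apply: le_trans H _; rewrite le_eqVlt; apply/orP; left; apply/eqP; ring.
have [v0|v0] := eqVneq (enorm v) 0.
  rewrite v0 mul0r /edot big1 // => i _.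
  have := coord_le_enorm v i; rewrite v0 normr_le0 => /eqP ->.
  by rewrite mul0r.
have [w0|w0] := eqVneq (enorm w) 0.
  rewrite w0 mulr0 /edot big1 // => i _.
  have := coord_le_enorm w i; rewrite w0 normr_le0 => /eqP ->.
  by rewrite mulr0.
rewrite -subr_ge0; move: P; rewrite pmulr_rge0 //.
by rewrite !mulr_gt0 ?mulrn_wgt0 // lt_def ?v0 ?w0 enorm_ge0.
Qed.

Lemma ler_enormD {R : realType} {n} (v w : 'rV[R]_n) :
  enorm (v + w) <= enorm v + enorm w.
Proof.
rewrite -(@ler_pXn2r _ 2) ?nnegrE ?addr_ge0 ?enorm_ge0 //.
rewrite sqr_enorm edotDl !edotDr (edotC w v) sqrrD !sqr_enorm.
have := cauchy_schwarz_edot v w; lra.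
Qed.

Lemma enorm_continuous {R : realType} {n} : continuous (@enorm R n).
Proof.
move=> x; apply: continuous_comp; last exact: sqrt_continuous.
apply: (@cvg_big _ _ _ _ _ _ _ _ _ (fun i (v : 'rV[R]_n) => v 0 i ^+ 2)) => [||i _].
- exact: add_continuous.
- exact: nbhs_filter.
by apply: (@continuous_comp _ _ _ (fun v : 'rV[R]_n => v 0 i) (fun t : R => t ^+ 2));
  [exact: coord_continuous | exact: exprn_continuous].
Qed.

Lemma continuous_subr {R : realType} {n} (c : 'rV[R]_n) :
  continuous (fun x : 'rV[R]_n => x - c).
Proof.
move=> x; have F : Filter (nbhs x) := nbhs_filter x.
exact: (@cvgB R _ _ (nbhs x) F id (cst c) x c (@cvg_id _ (nbhs x)) (cvg_cst c)).
Qed.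

Lemma continuous_enormB {R : realType} {n} (c : 'rV[R]_n) :
  continuous (fun x : 'rV[R]_n => enorm (x - c)).
Proof.
move=> x; apply: (@continuous_comp _ _ _ (fun x : 'rV[R]_n => x - c) (@enorm R n)).
  exact: continuous_subr.
exact: enorm_continuous.
Qed.

Lemma near_enorm {R : realType} {n} (x : 'rV[R]_n) (r : R) : 0 < r ->
  \forall x' \near x, enorm (x' - x) < r.
Proof.
move=> r0; have := continuous_enormB x x; rewrite /continuous_at subrr enorm0.
move=> /cvgrPdist_lt /(_ _ r0); apply: filterS => x'.
by rewrite sub0r normrN ger0_norm ?enorm_ge0.
Qed.

(** * Paraboloids as test functions *)

(** The difference quotient is exactly [A + h * B], so its limit is read off. This serves for
    paraboloids and, with [B = 0], for their affine partial derivatives. *)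
Lemma is_derive_quadratic {R : realType} {n} (f : 'rV[R]_n -> R) x v (A B : R) :
  (forall h : R, f (h *: v + x) - f x = h * A + h ^+ 2 * B) ->
  is_derive x v f A.
Proof.
move=> fE.
have cA : (fun h : R => h^-1 *: (f (h *: v + x) - f x)) @ 0^' --> A.
  have : (fun h : R => A + h * B) @ 0^' --> A.
    have C : (fun h : R => A + h * B) @ (0 : R) --> A.
      rewrite -[X in _ --> X]addr0 -[X in A + X](mul0r B).
      apply: cvgD; first exact: cvg_cst.
      by apply: cvgM; [exact: cvg_id | exact: cvg_cst].
    by move=> U /C; exact: nbhs_dnbhs.
  apply: cvg_trans; apply: near_eq_cvg; near=> h.
  have h0 : h != 0 by near: h; exact: nbhs_dnbhs_neq.
  by rewrite fE /GRing.scale /=; field.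
by apply: DeriveDef; [apply/cvg_ex; exists A | exact/cvg_lim].
Unshelve. all: by end_near. Qed.

(** All test functions chosen below have this form: positive [K] touches from above, negative [K]
    from below, and [K = 0] gives constants. *)
Definition paraboloid {R : realType} {n} (K : R) (c : 'rV[R]_n) (b : R) x : R :=
  K * edot (x - c) (x - c) + b.

Lemma continuous_affine {R : realType} {T : topologicalType} (f : T -> R) (k b : R) :
  continuous f -> continuous (fun x => k * f x + b).
Proof.
move=> cf x; apply: cvgD; last exact: cvg_cst.
by apply: cvgM; [exact: cvg_cst | exact: cf].
Qed.

Section Paraboloid.
Context {R : realType} {n : nat} (K : R) (c : 'rV[R]_n) (b : R).

Let derive_paraboloid i x :
  is_derive x (delta_mx 0 i) (paraboloid K c b) (2 * K * (x - c) 0 i).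
Proof.
apply: (@is_derive_quadratic _ _ _ _ _ _ K) => h.
rewrite /paraboloid -(addrA (h *: delta_mx 0 i)); move: (x - c) => u.
rewrite edotDl !edotDr !edotZl !edotZr (edotC _ u) !edot_delta mxE !eqxx /=.
ring.
Qed.

Let pderiv_paraboloid i :
  pderiv i (paraboloid K c b) = fun x => 2 * K * (x - c) 0 i.
Proof. by apply/funext => x; rewrite /pderiv; apply: derive_val; exact: derive_paraboloid. Qed.

Let derive2_paraboloid i j x :
  is_derive x (delta_mx 0 j) (pderiv i (paraboloid K c b)) (2 * K * (i == j)%:R).
Proof.
apply: (@is_derive_quadratic _ _ _ _ _ _ 0) => h.
rewrite pderiv_paraboloid !mxE eqxx /=; ring.
Qed.

Lemma gradv_paraboloid x : gradv (paraboloid K c b) x = (2 * K) *: (x - c).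
Proof. by apply/rowP => i; rewrite !mxE pderiv_paraboloid !mxE. Qed.

Lemma C2_paraboloid : C2 (paraboloid K c b).
Proof.
have cc i : continuous (fun x : 'rV[R]_n => 2 * K * (x - c) 0 i).
  rewrite (_ : (fun _ => _) = (fun x : 'rV[R]_n => 2 * K * x 0 i + 2 * K * - c 0 i)).
    by apply: continuous_affine; exact: coord_continuous.
  by apply/funext => x; rewrite !mxE mulrDr.
split.
- have -> : paraboloid K c b = (fun x => K * enorm (x - c) ^+ 2 + b).
    by apply/funext => x; rewrite sqr_enorm.
  apply: continuous_affine => x.
  apply: (@continuous_comp _ _ _ (fun x : 'rV[R]_n => enorm (x - c)) (fun t : R => t ^+ 2)).
    exact: continuous_enormB.
  exact: exprn_continuous.
- by move=> i x; have [] := derive_paraboloid i x.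
- by move=> i; rewrite pderiv_paraboloid.
- by move=> i j x; have [] := derive2_paraboloid i j x.
- move=> i j; have -> : pderiv j (pderiv i (paraboloid K c b)) = cst (2 * K * (i == j)%:R).
    by apply/funext => x; rewrite /pderiv; apply: derive_val; exact: derive2_paraboloid.
  exact: cst_continuous.
Qed.

End Paraboloid.

(** * Maxima of semicontinuous and of penalized functions *)

(** Two covering arguments indexed by [n]: the first bounds [f] on [K]; if the supremum were not
    attained, the second would keep [f] below it by a fixed 1 / (n + 1). *)
Lemma compact_usc_max {R : realType} {T : topologicalType} (K : set T) (f : T -> R) :
  compact K -> K !=set0 ->
  (forall x, K x -> forall e : R, 0 < e -> \forall x' \near x, f x' < f x + e) ->
  exists2 x, K x & forall y, K y -> f y <= f x.
Proof.
move=> /compact_near_coveringP cK [x0 Kx0] uf.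
have [M fM] : exists M, forall x, K x -> f x <= M.
  have [|n _ Hn] := cK nat \oo (fun n x => f x < n%:R) _ _; last first.
    by exists n%:R => x Kx; apply: ltW; apply: (Hn n) => //=.
  move=> x Kx; exists ([set x' | f x' < f x + 1], [set n : nat | f x + 1 < n%:R]).
    by split; [exact: uf | exact: nbhs_infty_gtr].
  by move=> [x' n] /= [/lt_trans]; exact.
have sK : has_sup (f @` K).
  by split; [exists (f x0), x0 | exists M => _ [x Kx <-]; exact: fM].
have fS x : K x -> f x <= sup (f @` K).
  by move=> Kx; apply: sup_upper_bound => //; exists x.
apply: contrapT => nmax.
have {}fS x : K x -> f x < sup (f @` K).
  move=> Kx; rewrite lt_neqAle fS // andbT; apply/eqP => fxS.
  by apply: nmax; exists x => // y /fS; rewrite fxS.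
have [|n _ Hn] := cK nat \oo (fun n x => f x < sup (f @` K) - n.+1%:R^-1) _ _.
  move=> x Kx; pose e := (sup (f @` K) - f x) / 2.
  have e0 : 0 < e by rewrite divr_gt0 // subr_gt0 fS.
  exists ([set x' | f x' < f x + e], [set n : nat | n.+1%:R^-1 < e]).
    by split; [exact: uf | exact: near_infty_natSinv_lt (PosNum e0)].
  move=> [x1 n] /= []; rewrite /e; set s := sup _; set q := n.+1%:R^-1 => ? ?; lra.
have : sup (f @` K) <= sup (f @` K) - n.+1%:R^-1.
  apply: sup_le_ub; first by exists (f x0), x0.
  by move=> _ [x Kx <-]; apply: ltW; apply: (Hn n) => /=.
by rewrite lerBrDr gerDl leNgt invr_gt0 ltr0Sn.
Qed.

Lemma compact_box {R : realType} n (p q : R) :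
  compact [set y : 'rV[R]_n | forall i, p <= y 0 i <= q].
Proof.
have := @rV_compact R n (fun=> `[p, q]%classic) (fun=> @segment_compact R p q).
by congr compact; apply/seteqP; split => y /= yT i; have := yT i; rewrite in_itv.
Qed.

Lemma translate_inT {R : realType} {n} (y : 'rV[R]_n) :
  exists k, inT (y + intvec R k).
Proof.
exists (\row_i - Num.floor (y 0 i)) => i; rewrite !mxE.
have /andP[] := floor_itv (y 0 i).
rewrite intrD mulrNz => ? ?; lra.
Qed.

Lemma usc_zperiodic_max {R : realType} {n} (u : 'rV[R]_n -> R) :
  usc u -> zperiodic u -> exists2 x, inT x & forall y, u y <= u x.
Proof.
move=> uu pu.
have [||x x01 xmax] := @compact_usc_max R _ (@inT R n) u (compact_box n 0 1).
- by exists 0 => i; rewrite mxE lexx ler01.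
- by move=> x _ e; exact: uu.
exists x => // y; have [k /xmax] := translate_inT y.
by rewrite pu.
Qed.

Lemma lscN {R : realType} {n} (u : 'rV[R]_n -> R) : lsc u -> usc (fun x => - u x).
Proof. by move=> lu y e /(lu y); apply: filterS => x; rewrite ltrBlDr => ?; lra. Qed.

Lemma lsc_zperiodic_min {R : realType} {n} (u : 'rV[R]_n -> R) :
  lsc u -> zperiodic u -> exists2 x, inT x & forall y, u x <= u y.
Proof.
move=> /lscN uu pu; have [|x xT xmax] := usc_zperiodic_max _ uu.
  by move=> y k /=; rewrite pu.
by exists x => // y; rewrite -lerN2.
Qed.

Lemma exists_sqr_gt {R : realType} (C K : R) : 0 < K -> exists2 r, 0 < r & C < K * r ^+ 2.
Proof.
move=> K0; exists (1 + `|C| / K); first by rewrite ltr_wpDr // divr_ge0 // ltW.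
have CK : 0 <= `|C| / K by rewrite divr_ge0 // ltW.
rewrite mulrC -ltr_pdivrMr //; apply: (@le_lt_trans _ _ (`|C| / K)).
  by rewrite ler_pM2r ?invr_gt0 // ler_norm.
apply: (@lt_le_trans _ _ (1 + `|C| / K)); first lra.
by rewrite expr2 ler_peMl; lra.
Qed.

(** A common integer shift leaves the penalized function unchanged and brings [x] into the unit
    cube. If a coordinate of [y] then exceeds [1 + r] in absolute value, the penalty is larger than
    [C] and the value falls below that at the origin. So a maximum over a compact box is global. *)
Lemma penalized_max {R : realType} {n} (U V : 'rV[R]_n -> R) (K : R) :
  usc U -> zperiodic U -> lsc V -> zperiodic V -> 0 < K ->
  exists x y, forall x' y',
    U x' - V y' - K * edot (x' - y') (x' - y') <= U x - V y - K * edot (x - y) (x - y).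
Proof.
move=> uU pU lV pV K0.
have [xU _ HU] := usc_zperiodic_max _ uU pU.
have [yV _ HV] := lsc_zperiodic_min _ lV pV.
pose C := U xU - V yV - (U 0 - V 0).
have [r r0 Kr] := exists_sqr_gt C K K0.
pose B := [set p : 'rV[R]_n * 'rV[R]_n | inT p.1 /\ forall i, - (1 + r) <= p.2 0 i <= 1 + r].
pose Psi (p : 'rV[R]_n * 'rV[R]_n) := U p.1 - V p.2 - K * enorm (p.1 - p.2) ^+ 2.
have B0 : B (0, 0) by split => i /=; rewrite !mxE; lra.
have cB : compact B := compact_setX (@compact_box R n 0 1) (@compact_box R n (- (1 + r)) (1 + r)).
have [||[x y] /= Bxy xymax] := @compact_usc_max R _ B Psi cB.
- by exists (0, 0).
- move=> [x y] _ e e0; have e3 : 0 < e / 3 by rewrite divr_gt0.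
  have cK : continuous (fun p : 'rV[R]_n * 'rV[R]_n => K * enorm (p.1 - p.2) ^+ 2 + 0).
    apply: continuous_affine => p.
    apply: (@continuous_comp _ _ _ (fun p : 'rV[R]_n * 'rV[R]_n => enorm (p.1 - p.2))
      (fun t : R => t ^+ 2)); last exact: exprn_continuous.
    have cS : {for p, continuous (fun p : 'rV[R]_n * 'rV[R]_n => p.1 - p.2)}.
      exact: sub_continuous.
    have cE : {for p.1 - p.2, continuous (@enorm R n)} by exact: enorm_continuous.
    exact: (continuous_comp cS cE).
  have /cvgrPdist_lt /(_ _ e3) HK := cK (x, y).
  have HUV : \forall p \near (x, y), U p.1 < U x + e / 3 /\ V y - e / 3 < V p.2.
    exists ([set p | U p < U x + e / 3], [set p | V y - e / 3 < V p]).
      by split; [exact: uU | exact: lV].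
    by move=> [? ?] [].
  apply: filterS2 HK HUV => -[x' y'] /=; rewrite /Psi /= !addr0 ltr_norml; lra.
exists x, y => x' y'.
rewrite -!sqr_enorm; have [k kT] := translate_inT x'.
have -> : U x' - V y' - K * enorm (x' - y') ^+ 2 = Psi (x' + intvec R k, y' + intvec R k).
  by rewrite /Psi /= pU pV opprD addrACA subrr addr0.
move: (x' + _) (y' + _) kT => {k}x' {}y' x'T.
have [y'B|] := pselect (forall i, - (1 + r) <= y' 0 i <= 1 + r); first exact: xymax.
move=> /existsNP[i /negP yi]; apply: le_trans (xymax _ B0).
rewrite /Psi /= subr0 enorm0 expr0n /= mulr0 subr0.
suff : K * r ^+ 2 <= K * enorm (x' - y') ^+ 2.
  have := HU x'; have := HV y'; move: Kr; rewrite /C; lra.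
rewrite ler_pM2l // ler_pXn2r ?nnegrE ?enorm_ge0 ?(ltW r0) //.
apply: le_trans (coord_le_enorm _ i); rewrite !mxE ler_normr.
have := x'T i; move: yi; rewrite negb_and -!ltNge => /orP[] ?; lra.
Qed.

(** * Uniform continuity and inequalities weighted by [a] *)

Definition ucont {R : realType} {n} (f : 'rV[R]_n -> R) :=
  forall e : R, 0 < e -> exists2 r : R, 0 < r &
    forall x y, enorm (x - y) < r -> `|f x - f y| <= e.

Lemma hoelder_ucont {R : realType} {n} (f : 'rV[R]_n -> R) (L th : R) :
  0 < th -> (forall x y, `|f x - f y| <= L * powR (enorm (x - y)) th) -> ucont f.
Proof.
move=> th0 fH e e0.
have L0 : 0 < `|L| + 1 by rewrite ltr_wpDl.
have d0 : 0 < e / (`|L| + 1) by rewrite divr_gt0.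
(* The radius inverts the Hoelder modulus, with [|L| + 1] as a positive bound for [L]. *)
exists (powR (e / (`|L| + 1)) th^-1); first exact: powR_gt0.
move=> x y xy; apply: le_trans (fH x y) _.
have P : powR (enorm (x - y)) th <= e / (`|L| + 1).
  have -> : e / (`|L| + 1) = powR (powR (e / (`|L| + 1)) th^-1) th.
    by rewrite -powRrM mulVf ?gt_eqF // powRr1 // ltW.
  by apply: ge0_ler_powR; rewrite ?nnegrE ?enorm_ge0 ?powR_ge0 // ltW.
apply: (@le_trans _ _ ((`|L| + 1) * powR (enorm (x - y)) th)).
  by rewrite ler_wpM2r ?powR_ge0 //; have := ler_norm L; lra.
by rewrite -ler_pdivlMl // mulrC.
Qed.

Lemma ucontN {R : realType} {n} (f : 'rV[R]_n -> R) : ucont f -> ucont (fun x => - f x).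
Proof.
move=> uf e /uf[r r0 H]; exists r => // x y xy.
by rewrite -opprD normrN; exact: H.
Qed.

Lemma ucont_usc {R : realType} {n} (f : 'rV[R]_n -> R) : ucont f -> usc f.
Proof.
move=> uf y e e0; have [|r r0 H] := uf (e / 2); first by rewrite divr_gt0.
have := near_enorm y _ r0; apply: filterS => x /H.
rewrite ler_norml; lra.
Qed.

Lemma ucont_zperiodic_bounded {R : realType} {n} (f : 'rV[R]_n -> R) :
  ucont f -> zperiodic f -> exists C, forall y, `|f y| <= C.
Proof.
move=> uf pf.
have [p _ Hp] := usc_zperiodic_max _ (ucont_usc _ uf) pf.
have [|q _ Hq] := usc_zperiodic_max _ (ucont_usc _ (ucontN _ uf)).
  by move=> y k /=; rewrite pf.
exists (Num.max (f p) (- f q)) => y.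
by rewrite ler_norml le_max Hp lerNl le_max (Hq y) orbT.
Qed.

(** [A] is at most B a1 / a2 = B + B (a1 - a2) / a2: removing the weight costs little when [a1] and
    [a2] are close. *)
Lemma le_of_weighted_le {R : realType} (A B S a1 a2 a0 : R) :
  0 < a0 -> a0 <= a1 -> a0 <= a2 -> A / a1 <= B / a2 -> `|B| <= S ->
  A <= B + S * `|a1 - a2| / a0.
Proof.
move=> a00 a01 a02 AB BS.
have a10 : 0 < a1 := lt_le_trans a00 a01.
have a20 : 0 < a2 := lt_le_trans a00 a02.
rewrite ler_pdivrMr // in AB; apply: le_trans AB _.
have -> : B / a2 * a1 = B + B * (a1 - a2) / a2.
  by field; rewrite gt_eqF.
rewrite lerD2l; apply: le_trans (ler_norm _) _.
rewrite !normrM normfV (gtr0_norm a20) ler_pM ?mulr_ge0 ?invr_ge0 ?(ltW a20) //.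
  by rewrite ler_wpM2r.
by rewrite lef_pV2 ?posrE.
Qed.

(** Both viscosity inequalities are solved for their integrals, and [I <= I'] links them. *)
Lemma divr_le_divr_of_le {R : realType} (g a I c g' a' I' c' : R) :
  0 < a -> 0 < a' -> g - a * I <= c -> c' <= g' - a' * I' -> I <= I' ->
  (g - c) / a <= (g' - c') / a'.
Proof.
move=> a0 a'0 gc c'g' II'; apply: (@le_trans _ _ I).
  by rewrite ler_pdivrMr // mulrC; lra.
by apply: (le_trans II'); rewrite ler_pdivlMr // mulrC; lra.
Qed.

(** * Comparison by doubling the variables *)

Section Comparison.
Context {R : realType} {N M : nat} (withgrad : bool).
Context (mu : {measure set (borelRV R M) -> \bar R}).
Context (beta : 'rV[R]_M -> 'rV[R]_N) (a : 'rV[R]_N -> R).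

Notation vsub := (vsub withgrad mu beta a).
Notation vsuper := (vsuper withgrad mu beta a).

(* Both integrands at a maximum of [U x - V y - K |x - y|^2] use the same
   gradient [2 K (x - y)], and shifting [x] and [y] by the same [beta z] leaves
   the penalization unchanged: the integrands compare pointwise, so no second
   order term has to be controlled. *)
Lemma doubling (G1 G2 : 'rV[R]_N -> R -> R) (c1 c2 : R) (U V : 'rV[R]_N -> R) (K : R) :
  (forall y, 0 < a y) -> vsub G1 c1 U -> vsuper G2 c2 V -> 0 < K ->
  exists x y, (forall x' y',
    U x' - V y' - K * enorm (x' - y') ^+ 2 <= U x - V y - K * enorm (x - y) ^+ 2) /\
    (G1 x (U x) - c1) / a x <= (G2 y (V y) - c2) / a y.
Proof.
move=> a0 [uU [pU sU]] [lV [pV sV]] K0.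
have [x [y xymax]] := penalized_max _ _ _ uU pU lV pV K0.
exists x, y; split; first by move=> x' y'; rewrite !sqr_enorm; exact: xymax.
have [|||iU eU] := sU x (paraboloid K y (U x - K * edot (x - y) (x - y))).
- exact: C2_paraboloid.
- by move=> x'; have := xymax x' y; rewrite /paraboloid; lra.
- by rewrite /paraboloid; lra.
have [|||iV eV] := sV y (paraboloid (- K) x (V y + K * edot (y - x) (y - x))).
- exact: C2_paraboloid.
- move=> y'; have := xymax x y'; rewrite /paraboloid -(edotNN (y' - x)) -(edotNN (y - x)).
  by rewrite !opprB; lra.
- by rewrite /paraboloid; lra.
apply: (divr_le_divr_of_le _ _ _ _ _ _ _ _ (a0 x) (a0 y) eU eV).
apply: (le_Rintegral measurableT iU iV).
move=> {eU eV iU iV} z _; rewrite /integrand !gradv_paraboloid.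
have -> : (2 * - K) *: (y - x) = (2 * K) *: (x - y).
  by rewrite mulrN scaleNr -scalerN opprB.
rewrite lerD2r.
have := xymax (x + beta z) (y + beta z).
have -> : x + beta z - (y + beta z) = x - y by rewrite opprD addrACA subrr addr0.
lra.
Qed.

(** Comparing the maximum with the pair (0, 0) gives K |x - y|^2 <= S < K r^2, so the maximum lies
    within [r] of the diagonal. *)
Lemma doubling_enorm (G1 G2 : 'rV[R]_N -> R -> R) (c1 c2 : R) (U V : 'rV[R]_N -> R)
    (K S r : R) :
  (forall y, 0 < a y) -> vsub G1 c1 U -> vsuper G2 c2 V -> 0 < K -> 0 < r ->
  (forall x y, U x - V y - (U 0 - V 0) <= S) -> S < K * r ^+ 2 ->
  exists x y, [/\ enorm (x - y) < r, (forall x' y',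
    U x' - V y' <= U x - V y + K * enorm (x' - y') ^+ 2) &
    (G1 x (U x) - c1) / a x <= (G2 y (V y) - c2) / a y].
Proof.
move=> a0 sU sV K0 r0 HS SKr.
have [x [y [xymax xyle]]] := doubling _ _ _ _ _ _ _ a0 sU sV K0.
exists x, y; split=> //.
  rewrite -(@ltr_pXn2r _ 2) ?nnegrE ?enorm_ge0 ?(ltW r0) // -(ltr_pM2l K0).
  have := xymax 0 0; rewrite subrr enorm0 expr0n /= mulr0 subr0.
  by have := HS x y; lra.
move=> x' y'; have := xymax x' y'.
have : 0 <= K * enorm (x - y) ^+ 2 by rewrite mulr_ge0 ?sqr_ge0 ?ltW.
lra.
Qed.

(** At a doubled maximum near the diagonal, [p - f x <= q - f y] holds up to the variation of [a],
    and uniform continuity makes all errors small. As [G1] and [G2] are unrelated, resolvent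
    equations for different [lam] and corrector equations can be compared with each other. *)
Lemma comparison_const (G1 G2 : 'rV[R]_N -> R -> R) (c1 c2 : R) (U V : 'rV[R]_N -> R)
    (f : 'rV[R]_N -> R) (a0 p q : R) :
  0 < a0 -> (forall y, a0 <= a y) -> ucont a -> ucont f -> zperiodic f ->
  vsub G1 c1 U -> vsuper G2 c2 V ->
  (forall y, p - f y <= G1 y (U y) - c1) -> (forall y, G2 y (V y) - c2 <= q - f y) ->
  p <= q.
Proof.
move=> a00 a0a ua uf pf sU sV HU HV.
have ay y : 0 < a y by apply: lt_le_trans a00 _.
have [C fC] := ucont_zperiodic_bounded _ uf pf.
have [xU _ xUmax] := usc_zperiodic_max _ sU.1 sU.2.1.
have [yV _ yVmin] := lsc_zperiodic_min _ sV.1 sV.2.1.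
apply/ler_addgt0Pr => e e0.
(* [S] bounds |q - f y|, the factor of the variation of [a]. *)
pose S := `|q| + C.
have S0 : 0 <= S by rewrite addr_ge0 // (le_trans _ (fC 0)).
have [|ra ra0 Ha] := ua (e / 2 * a0 / (S + 1)).
  by rewrite !divr_gt0 ?mulr_gt0 ?divr_gt0 // ltr_wpDl.
have [|rf rf0 Hf] := uf (e / 2); first by rewrite divr_gt0.
pose r := Num.min ra rf.
have r0 : 0 < r by rewrite lt_min ra0.
pose D := `|U xU - V yV - (U 0 - V 0)|.
(* Then K r^2 = D + 1 exceeds [D], which bounds the increase of [U x - V y] from the origin. *)
pose K := (D + 1) / r ^+ 2.
have r20 : 0 < r ^+ 2 by rewrite exprn_gt0.
have K0 : 0 < K by rewrite divr_gt0 // ltr_wpDl // normr_ge0.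
have DK : D < K * r ^+ 2 by rewrite divfK ?gt_eqF // ltrDl.
have [|x [y [xy _ le_xy]]] := doubling_enorm _ _ _ _ _ _ _ _ _ ay sU sV K0 r0 _ DK.
  move=> x y; apply: le_trans (ler_norm _).
  by have := xUmax x; have := yVmin y; lra.
move: xy; rewrite lt_min => /andP[/Ha xya /Hf xyf].
have : p - f x <= q - f y + S * `|a x - a y| / a0.
  apply: (le_of_weighted_le _ _ _ _ _ _ a00 (a0a x) (a0a y)).
    apply: (@le_trans _ _ ((G1 x (U x) - c1) / a x)).
      by rewrite ler_pM2r ?invr_gt0.
    apply: (le_trans le_xy).
    by rewrite ler_pM2r ?invr_gt0.
  by apply: le_trans (ler_normB _ _) _; rewrite lerD2l.
have : S * `|a x - a y| / a0 <= e / 2.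
  rewrite ler_pdivrMr //.
  have S1 : 0 < S + 1 by rewrite ltr_wpDl.
  move: xya; rewrite ler_pdivlMr // => xya; apply: le_trans xya.
  by rewrite mulrC ler_wpM2l // lerDl.
by move: (S * _ / a0) xyf => t; rewrite ler_norml; lra.
Qed.

End Comparison.

(** * Integrability of the Levy weight and Markov's inequality *)

Lemma measurable_continuous_borelRV {R : realType} {m} (f : 'rV[R]_m -> R) :
  continuous f -> measurable_fun (setT : set (borelRV R m)) f.
Proof.
move=> cf; apply: (measurability (@RGenOpens.G R) (@RGenOpens.measurableE R)).
move=> _ [_ [p [q ->]] <-]; rewrite setTI.
apply: sub_sigma_algebra.
by apply: open_comp => // x _; exact: cf.
Qed.

(** Merges the two integrands of [moment_cond] into one function, whose multiples bound the nonlocal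
    integrand from above. *)
Definition levy_weight {R : realType} {m} (gam : nat) (z : 'rV[R]_m) : R :=
  if enorm z < 1 then enorm z ^+ gam else enorm z ^+ gam.-1.

Lemma levy_weight_ge0 {R : realType} {m} gam (z : 'rV[R]_m) : 0 <= levy_weight gam z.
Proof. by rewrite /levy_weight; case: ifP => _; rewrite exprn_ge0 ?enorm_ge0. Qed.

Lemma integrable_levy_weight {R : realType} {m} gam
    (mu : {measure set (borelRV R m) -> \bar R}) :
  moment_cond gam mu -> mu.-integrable setT (EFin \o levy_weight gam).
Proof.
have mX k : measurable_fun (setT : set (borelRV R m)) (fun z : 'rV[R]_m => enorm z ^+ k).
  apply: measurable_continuous_borelRV => z.
  have cE : {for z, continuous (@enorm R m)} by exact: enorm_continuous.
  have cX : {for enorm z, continuous (fun t : R => t ^+ k)} by exact: exprn_continuous.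
  exact: (continuous_comp cE cX).
have m1 : measurable ([set z : borelRV R m | enorm z < 1]).
  have := mX 1%N measurableT _ (measurable_itv `]-oo, (1 : R)[).
  by congr measurable; apply/seteqP; split => z /=; rewrite in_itv /= expr1 //; move=> [].
pose S := [set z : borelRV R m | enorm z < 1].
have SC : [set z : borelRV R m | 1 <= enorm z] = ~` S.
  by apply/seteqP; split => z /=; rewrite /S /= leNgt => /negP.
rewrite /moment_cond SC => mom.
have w0 (z : 'rV[R]_m) : (0 <= (levy_weight gam z)%:E :> \bar R)%E by rewrite lee_fin levy_weight_ge0.
have mw : measurable_fun (setT : set (borelRV R m)) (levy_weight gam).
  rewrite -(setUv S); apply/measurable_funU => //; first exact: measurableC.
  split.
    apply: (eq_measurable_fun (fun z : borelRV R m => enorm z ^+ gam)).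
      by move=> z; rewrite inE /S /= /levy_weight => ->.
    exact: measurable_funS (mX gam).
  apply: (eq_measurable_fun (fun z : borelRV R m => enorm z ^+ gam.-1)).
    by move=> z; rewrite inE /S /= /levy_weight => /negP/negbTE ->.
  exact: measurable_funS (mX gam.-1).
apply/integrableP; split; first exact/measurable_EFinP.
rewrite (eq_integral (fun z : borelRV R m => (levy_weight gam z)%:E)); last by move=> z _; rewrite /= ger0_norm ?levy_weight_ge0.
rewrite -(setUv S) ge0_integral_setU //=.
- congr (_ < +oo)%E : mom; congr (_ + _)%E; apply: eq_integral => z.
    by rewrite inE /S /= /levy_weight => ->.
  by rewrite inE /S /= /levy_weight => /negP/negbTE ->.
- exact: measurableC.
- by rewrite setUv; exact/measurable_EFinP.
- by apply/disj_set2P; rewrite setICr.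
Qed.

(** Markov's inequality, with a real lower bound [k] of [mu J] so that both sides are real. *)
Lemma markov_Rintegral {R : realType} d (T : measurableType d)
    (mu : {measure set T -> \bar R}) (f : T -> R) (J : set T) (c k : R) :
  measurable J -> mu.-integrable setT (EFin \o f) -> (forall z, 0 <= f z) ->
  0 <= c -> (forall z, J z -> c <= f z) -> (k%:E <= mu J)%E ->
  c * k <= fine (\int[mu]_z (f z)%:E).
Proof.
move=> mJ fi f0 c0 cf kJ.
have /measurable_EFinP mf := measurable_int _ fi.
rewrite -lee_fin fineK ?(integrable_fin_num _ fi) // EFinM.
apply: (@le_trans _ _ (\int[mu]_(z in J) cst c%:E z)%E).
  by rewrite integral_cst // lee_wpmul2l.
apply: (@le_trans _ _ (\int[mu]_(z in J) (f z)%:E)%E).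
  apply: ge0_le_integral => //.
  by apply: measurable_funTS; exact/measurable_EFinP.
apply: ge0_subset_integral => //; first exact/measurable_EFinP.
by move=> z _; rewrite lee_fin.
Qed.

(** * Bounds on [lam * v lam] *)

Section Bounds.
Context {R : realType} {N M : nat} (withgrad : bool).
Context (mu : {measure set (borelRV R M) -> \bar R}).
Context (beta : 'rV[R]_M -> 'rV[R]_N) (a : 'rV[R]_N -> R).

(** At a maximum point a constant is an admissible test function: its gradient vanishes, the
    integrand is nonpositive, and the equation leaves lam u <= f there. *)
Lemma vsub_resolvent_le (f u : 'rV[R]_N -> R) (lam C : R) :
  0 < lam -> (forall y, 0 < a y) -> (forall y, f y <= C) ->
  vsub withgrad mu beta a (fun y r => lam * r - f y) 0 u -> forall y, lam * u y <= C.
Proof.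
move=> lam0 a0 fC [uu [pu su]] y.
have [x _ xmax] := usc_zperiodic_max _ uu pu.
have [|||ui] := su x (paraboloid 0 x (u x)); first exact: C2_paraboloid.
- by move=> y'; rewrite /paraboloid !mul0r !add0r lerD2r.
- by rewrite /paraboloid mul0r add0r.
move=> le0; apply: (@le_trans _ _ (lam * u x)); first by rewrite ler_pM2l.
apply: le_trans (fC x); rewrite -subr_le0; apply: le_trans le0.
rewrite lerDl oppr_ge0 pmulr_rle0 //; apply: fine_le0.
rewrite -(integral0 mu setT).
apply: le_integral => //; first exact: integrable0.
move=> z _; rewrite lee_fin /integrand gradv_paraboloid mulr0 scale0r.
rewrite (_ : edot 0 (beta z) = 0) ?if_same ?subr0 ?subr_le0 //.
by rewrite /edot big1 // => i _; rewrite mxE mul0r.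
Qed.

Lemma vsuper_resolvent_ge (f u : 'rV[R]_N -> R) (lam C : R) :
  0 < lam -> (forall y, 0 < a y) -> (forall y, C <= f y) ->
  vsuper withgrad mu beta a (fun y r => lam * r - f y) 0 u -> forall y, C <= lam * u y.
Proof.
move=> lam0 a0 fC [lu [pu su]] y.
have [x _ xmin] := lsc_zperiodic_min _ lu pu.
have [|||ui] := su x (paraboloid 0 x (u x)); first exact: C2_paraboloid.
- by move=> y'; rewrite /paraboloid !mul0r !add0r lerD2r.
- by rewrite /paraboloid mul0r add0r.
move=> ge0; apply: (@le_trans _ _ (lam * u x)); last by rewrite ler_pM2l.
apply: le_trans (fC x) _; rewrite -subr_ge0; apply: le_trans ge0 _.
rewrite gerDl oppr_le0 pmulr_rge0 //; apply: fine_ge0; apply: integral_ge0 => z _.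
rewrite lee_fin /integrand gradv_paraboloid mulr0 scale0r.
rewrite (_ : edot 0 (beta z) = 0) ?if_same ?subr0 ?subr_ge0 //.
by rewrite /edot big1 // => i _; rewrite mxE mul0r.
Qed.

End Bounds.

(** * The nonlocal estimate behind the strong maximum principle *)

(** Scalar core of the nonlocal estimate: [t] is |z|, [d] the increment u(x + beta z) - u(x), [P]
    the gap m - u(x + beta z), [s] the gap m - u(y); [2 * kg] and [kb] are the linear and quadratic
    parts of the paraboloid's increment. For the sign of [D], the paraboloid bounds [d] when
    [t < 1], and [s] bounds it otherwise. *)
Lemma levy_integrand_bound {R : realType} (wg : bool) (t s kq kB kg kb d P : R) :
  0 <= t -> 0 <= s -> 0 <= kq -> 0 <= kB ->
  - (kq * t) <= kg -> kg <= kq * t -> kb <= kB * t ^+ 2 ->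
  d <= 2 * kg + kb -> 0 <= P -> d + P <= s ->
  let g := if wg then 2%N else 1%N in
  let D := (s + 2 * kq + kB) * (if t < 1 then t ^+ g else t ^+ g.-1) -
           (d - if wg then 2 * kg else 0) in
  0 <= D /\ P - s - 2 * kq <= D.
Proof.
move=> t0 s0 q0 B0 g1 g2 b1 d1 P0 dP /=.
have st2 : 0 <= s * t ^+ 2 by rewrite mulr_ge0 ?exprn_ge0.
have qt2 : 0 <= kq * t ^+ 2 by rewrite mulr_ge0 ?exprn_ge0.
have Bt2 : 0 <= kB * t ^+ 2 by rewrite mulr_ge0 ?exprn_ge0.
have st : 0 <= s * t by rewrite mulr_ge0.
have qt : 0 <= kq * t by rewrite mulr_ge0.
have Bt : 0 <= kB * t by rewrite mulr_ge0.
rewrite (mulrDl _ kB) (mulrDl s) -(mulrA 2 kq); case: wg => /=; case: ltP => t1; rewrite ?expr1 ?expr0 ?mulr1.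
- have qt1 : kq * t <= kq by rewrite ler_piMr // ltW.
  by lra.
- have st1 : s <= s * t by rewrite ler_peMr.
  by lra.
- have Btt : kB * t ^+ 2 <= kB * t by rewrite ler_wpM2l // expr2 ler_piMr // ltW.
  by lra.
- by lra.
Qed.

(** Outside a large box the penalty exceeds [m - u y], so the value there is below that at [y] and
    the maximum over the box is global. *)
Lemma penalized_max_at {R : realType} {n} (u : 'rV[R]_n -> R) (m K : R) y :
  usc u -> (forall x, u x <= m) -> 0 < K ->
  exists x, forall x', u x' - K * edot (x' - y) (x' - y) <= u x - K * edot (x - y) (x - y).
Proof.
move=> uu um K0.
have [r r0 Kr] := exists_sqr_gt (m - u y) K K0.
pose b := enorm y + r.
pose B := [set x : 'rV[R]_n | forall i, - b <= x 0 i <= b].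
pose psi (x : 'rV[R]_n) := u x - K * enorm (x - y) ^+ 2.
have By : B y.
  move=> i; rewrite -ler_norml; apply: (le_trans (coord_le_enorm y i)).
  by rewrite lerDl ltW.
have [||x _ xmax] := @compact_usc_max R _ B psi (compact_box _ _ _).
- by exists y.
- move=> x _ e e0; have e2 : 0 < e / 2 by rewrite divr_gt0.
  have cK : continuous (fun x : 'rV[R]_n => K * enorm (x - y) ^+ 2 + 0).
    apply: continuous_affine => x'.
    have cE : {for x', continuous (fun x : 'rV[R]_n => enorm (x - y))}.
      exact: continuous_enormB.
    have cX : {for enorm (x' - y), continuous (fun t : R => t ^+ 2)} by exact: exprn_continuous.
    exact: (continuous_comp cE cX).
  have /cvgrPdist_lt /(_ _ e2) HK := cK x.
  apply: filterS2 HK (uu x _ e2) => x'; rewrite /psi /= !addr0 ltr_norml; lra.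
exists x => x'; rewrite -!sqr_enorm.
have [x'B|] := pselect (B x'); first exact: xmax.
move=> /existsNP[i /negP]; rewrite -ler_norml -ltNge => xi.
apply: le_trans (xmax _ By); rewrite /psi subrr enorm0 expr0n /= mulr0 subr0.
suff : K * r ^+ 2 <= K * enorm (x' - y) ^+ 2 by have := um x'; move: Kr; lra.
rewrite ler_pM2l // ler_pXn2r ?nnegrE ?enorm_ge0 ?(ltW r0) //.
apply: le_trans (coord_le_enorm _ i); rewrite !mxE.
have := lerB_dist (x' 0 i) (y 0 i); have := coord_le_enorm y i; move: xi; rewrite /b; lra.
Qed.

Lemma oppr_le_div {R : realType} (g h b I : R) :
  0 < b -> g - h - b * I <= 0 -> - I <= (h - g) / b.
Proof. by move=> b0; rewrite ler_pdivlMr // mulNr mulrC; lra. Qed.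

Section Step.
Context {R : realType} {N M : nat} (withgrad : bool).
Context (mu : {measure set (borelRV R M) -> \bar R}).
Context (beta : 'rV[R]_M -> 'rV[R]_N) (a : 'rV[R]_N -> R).

Let gam := if withgrad then 2%N else 1%N.

(* Touching [u] from above by [K |. - y|^2] near a point [y] where [u] is almost
   maximal, the nonlocal term controls how much mass jumps from there to points
   where [u] is far from its maximum. *)
Lemma nonlocal_estimate (f u : 'rV[R]_N -> R) (lam B m K : R) (y : 'rV[R]_N) :
  (forall y, 0 < a y) -> 0 <= B -> (forall z, enorm (beta z) <= B * enorm z) ->
  mu.-integrable setT (EFin \o levy_weight gam) ->
  vsub withgrad mu beta a (fun y r => lam * r - f y) 0 u ->
  (forall x, u x <= m) -> 0 < K ->
  exists2 x, K * enorm (x - y) ^+ 2 <= m - u y &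
    forall (J : set (borelRV R M)) c k, measurable J -> 0 <= c -> (k%:E <= mu J)%E ->
      (forall z, J z ->
         c <= m - u (x + beta z) - (m - u y) - 2 * (K * enorm (x - y) * B)) ->
      c * k <= (m - u y + 2 * (K * enorm (x - y) * B) + K * B ^+ 2) *
               fine (\int[mu]_z (levy_weight gam z)%:E) + (f x - lam * u x) / a x.
Proof.
move=> a0 B0 betaB wi [uu [pu su]] um K0.
have [x xmax] := penalized_max_at u m K y uu um K0.
have [|||ui ule] := su x (paraboloid K y (u x - K * edot (x - y) (x - y))).
- exact: C2_paraboloid.
- by move=> x'; have := xmax x'; rewrite /paraboloid; lra.
- by rewrite /paraboloid; lra.
(* Maximality tested at [y] itself: K |x - y|^2 <= u x - u y <= m - u y. *)
have xy := xmax y; rewrite subrr -!sqr_enorm enorm0 expr0n /= mulr0 subr0 in xy.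
have Kxy0 : 0 <= K * enorm (x - y) ^+ 2 by rewrite mulr_ge0 ?sqr_ge0 ?ltW.
exists x; first by have := um x; clear ule; lra.
move=> J c k mJ c0 kJ cJ.
set A := m - u y + _ + _.
pose I z := integrand withgrad beta u (paraboloid K y (u x - K * edot (x - y) (x - y))) x z.
(* [A] times the Levy weight dominates the integrand, and the difference is at least [c] on [J]:
   Markov's inequality is applied to this difference. *)
have D0 z : 0 <= A * levy_weight gam z - I z /\
    m - u (x + beta z) - (m - u y) - 2 * (K * enorm (x - y) * B) <= A * levy_weight gam z - I z.
  rewrite /I /integrand /levy_weight gradv_paraboloid edotZl -mulrA.
  clear ule; apply: (levy_integrand_bound _ _ _ _ _ _ (K * edot (beta z) (beta z))).
  - exact: enorm_ge0.
  - by have := um y; lra.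
  - by rewrite !mulr_ge0 ?enorm_ge0 // ltW.
  - by rewrite mulr_ge0 ?exprn_ge0 // ltW.
  - rewrite -mulrN -!mulrA ler_pM2l //.
    have := cauchy_schwarz_edot (- (x - y)) (beta z); rewrite enormN -scaleN1r edotZl mulN1r.
    have := ler_wpM2l (enorm_ge0 (x - y)) (betaB z); lra.
  - rewrite -!mulrA ler_pM2l //.
    apply: le_trans (cauchy_schwarz_edot _ _) _.
    by rewrite ler_wpM2l ?enorm_ge0.
  - rewrite -mulrA ler_pM2l // -sqr_enorm -exprMn.
    by rewrite ler_pXn2r ?nnegrE ?mulr_ge0 ?enorm_ge0.
  - have := xmax (x + beta z).
    have -> : x + beta z - y = (x - y) + beta z by rewrite addrAC.
    by move: (x - y) => w; rewrite edotDl !edotDr (edotC (beta z) w); lra.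
  - by rewrite subr_ge0.
  - by lra.
have Ai : mu.-integrable setT (EFin \o (fun z => A * levy_weight gam z)).
  exact: (integrableZl measurableT A wi).
have Di : mu.-integrable setT (EFin \o (fun z => A * levy_weight gam z - I z)).
  exact: (integrableB measurableT Ai ui).
apply: le_trans (markov_Rintegral _ _ mu _ J c k mJ Di _ c0 _ kJ) _.
- by move=> z; have [] := D0 z.
- by move=> z /cJ cz; apply: le_trans cz _; have [] := D0 z.
have := RintegralB measurableT Ai ui; rewrite /Rintegral => ->.
have := RintegralZl A measurableT wi; rewrite /Rintegral => ->.
rewrite lerD2l.
exact: oppr_le_div ule.
Qed.
End Step.

(** * Equicontinuity and vanishing oscillation of [lam * v lam] *)

Lemma exists_fin_pos_le {R : realType} (x : \bar R) :
  (0 < x)%E -> exists2 k : R, 0 < k & (k%:E <= x)%E.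
Proof.
case: x => [r||] //; first by rewrite lte_fin => r0; exists r.
by move=> _; exists 1 => //; rewrite leey.
Qed.

Section Ergodic.
Context {R : realType} {N M : nat} (withgrad : bool).
Context (mu : {measure set (borelRV R M) -> \bar R}).
Context (beta : 'rV[R]_M -> 'rV[R]_N) (a f : 'rV[R]_N -> R).
Context (v : R -> 'rV[R]_N -> R) (a0 B C : R).

Let gam := if withgrad then 2%N else 1%N.

Context (a00 : 0 < a0).
Context (a0a : forall y, a0 <= a y).
Context (ua : ucont a).
Context (uf : ucont f).
Context (B0 : 0 <= B).
Context (betaB : forall z, enorm (beta z) <= B * enorm z).
Context (wi : mu.-integrable setT (EFin \o levy_weight gam)).
Context (fC : forall y, `|f y| <= C).
Context (sv : forall lam : R, 0 < lam ->
  vsol withgrad mu beta a (fun y r => lam * r - f y) 0 (v lam)).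

Let apos y : 0 < a y. Proof. exact: lt_le_trans (a0a y). Qed.

Let C0 : 0 <= C. Proof. exact: le_trans (fC 0). Qed.

Lemma resolvent_bounded lam y : 0 < lam -> `|lam * v lam y| <= C.
Proof.
move=> lam0; have [_ [sub sup]] := sv _ lam0.
rewrite ler_norml; apply/andP; split.
  apply: (vsuper_resolvent_ge _ _ _ _ _ _ _ _ lam0 apos _ sup) => x.
  by have := fC x; rewrite ler_norml => /andP[].
apply: (vsub_resolvent_le _ _ _ _ _ _ _ _ lam0 apos _ sub) => x.
by have := fC x; rewrite ler_norml => /andP[].
Qed.

(** [v lam] is doubled against itself with penalty [K / lam]; after multiplication by [lam] no
    constant depends on [lam]. At the maximum, [f] and [a] contribute [e / 4] each, and the radius
    keeps the penalty at (x, y) below [e / 2]. *)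
Lemma resolvent_equicontinuous (e : R) : 0 < e ->
  exists2 r, 0 < r & forall lam x y, 0 < lam -> enorm (x - y) < r ->
    lam * v lam x - lam * v lam y <= e.
Proof.
move=> e0.
pose S := C + C.
have S0 : 0 <= S by rewrite addr_ge0.
have S1 : 0 < S + 1 by rewrite ltr_wpDl.
have [|ra ra0 Ha] := ua (e / 4 * a0 / (S + 1)).
  by rewrite !divr_gt0 ?mulr_gt0 ?divr_gt0.
have [|rf rf0 Hf] := uf (e / 4); first by rewrite divr_gt0.
pose r := Num.min ra rf.
have r0 : 0 < r by rewrite lt_min ra0.
have r20 : 0 < r ^+ 2 by rewrite exprn_gt0.
pose K := (S + 1) / r ^+ 2.
have K0 : 0 < K by rewrite divr_gt0.
have rho0 : 0 < e / 2 / K by rewrite !divr_gt0.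
exists (Num.sqrt (e / 2 / K)); first by rewrite sqrtr_gt0.
move=> lam x y lam0 xy; have [_ [sub sup]] := sv _ lam0.
have Kl0 : 0 < K / lam by rewrite divr_gt0.
have [||p [q [pq pqmax le_pq]]] :=
    doubling_enorm _ _ _ _ _ _ _ _ _ _ _ (S / lam) r apos sub sup Kl0 r0.
- move=> p q; rewrite ler_pdivlMr // mulrC subrr subr0 mulrBr.
  have := resolvent_bounded _ p lam0; have := resolvent_bounded _ q lam0.
  by rewrite !ler_norml /S; lra.
- by rewrite mulrAC ltr_pM2r ?invr_gt0 // divfK ?gt_eqF // ltrDl.
move: pq; rewrite lt_min => /andP[/Ha pqa /Hf pqf].
have : lam * v lam p - f p <= lam * v lam q - f q + S * `|a p - a q| / a0.
  apply: (le_of_weighted_le _ _ _ _ _ _ a00 (a0a p) (a0a q)).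
    by rewrite -[leLHS]subr0 -[leRHS]subr0 in le_pq *; rewrite !subr0 in le_pq *.
  apply: le_trans (ler_normB _ _) _; rewrite lerD // ?resolvent_bounded //.
have : S * `|a p - a q| / a0 <= e / 4.
  rewrite ler_pdivrMr //.
  move: pqa; rewrite ler_pdivlMr // => pqa; apply: le_trans pqa.
  by rewrite mulrC ler_wpM2l // lerDl.
move: (S * _ / a0) => t te pqt.
have Kxy : K * enorm (x - y) ^+ 2 <= e / 2.
  rewrite mulrC -ler_pdivlMr // -(sqr_sqrtr (ltW rho0)).
  by rewrite ler_pXn2r ?nnegrE ?enorm_ge0 ?sqrtr_ge0 // ltW.
have := pqmax x y; rewrite -(ler_pM2l lam0) [leRHS]mulrDr !mulrBr.
have -> : lam * (K / lam * enorm (x - y) ^+ 2) = K * enorm (x - y) ^+ 2.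
  by field; rewrite gt_eqF.
by move: pqf; rewrite ler_norml; lra.
Qed.

(** Propagation of near-maximality, uniform in small [lam]. The tolerance [d] of one link serves as
    the [e] of the preceding one, so links compose along chains. *)
Let linked (y y' : 'rV[R]_N) := forall e : R, 0 < e ->
  exists d l0 : R, [/\ 0 < d, 0 < l0 & forall lam m, 0 < lam -> lam < l0 ->
    (forall x, lam * v lam x <= m) -> m - lam * v lam y < d ->
    m - lam * v lam y' < e].

Let linked_refl y : linked y y.
Proof. by move=> e e0; exists e, 1; split. Qed.

Let linked_trans y1 y2 y3 : linked y1 y2 -> linked y2 y3 -> linked y1 y3.
Proof.
move=> L12 L23 e /L23[d2 [l2 [d20 l20 H2]]].
have [d1 [l1 [d10 l10 H1]]] := L12 _ d20.
exists d1, (Num.min l1 l2); split; rewrite ?lt_min ?l10 //.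
move=> lam m lam0; rewrite lt_min => /andP[ll1 ll2] lm /(H1 _ _ lam0 ll1 lm).
exact: H2.
Qed.

(** If [lam * v lam] were [e] below [m] at [y'], equicontinuity would keep it well below [m]
    wherever [J] jumps from a point [x] near [y]. The nonlocal estimate times [lam] would then give
    [4 * t <= 3 * t]. *)
Let linked_jump y y' :
  (forall eps : R, 0 < eps -> exists J : set (borelRV R M),
     [/\ measurable J, (0 < mu J)%E & forall z, J z -> exists kz : 'rV[int]_N,
        enorm (y + beta z - y' - intvec R kz) < eps]) -> linked y y'.
Proof.
move=> HJ e e0.
have [|r r0 Hr] := resolvent_equicontinuous (e / 4); first by rewrite divr_gt0.
(* |x - y| and the inaccuracy of the jump add up to less than [r]; [eps <= 1] absorbs the factor |x
   - y| of the gradient term. *)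
pose eps := Num.min r 1 / 2.
have eps0 : 0 < eps by rewrite divr_gt0 // lt_min r0 ltr01.
have eps2 : eps + eps <= r by rewrite -splitr ge_min lexx.
have eps1 : eps <= 1 by rewrite /eps ler_pdivrMr // ge_min; apply/orP; right; lra.
have [J [mJ J0 Jz]] := HJ eps eps0.
have [k k0 kJ] := exists_fin_pos_le _ J0.
pose Q := fine (\int[mu]_z (levy_weight gam z)%:E).
have Q0 : 0 <= Q.
  by apply: fine_ge0; apply: integral_ge0 => z _; rewrite lee_fin levy_weight_ge0.
(* The left side [e / 4 * k] of the estimate is [4 * t]; each of the three error terms will be at
   most [t]. *)
pose t := e * k / 16.
have t0 : 0 < t by rewrite divr_gt0 // mulr_gt0.
pose Cb := 2 * B + B ^+ 2.
have Cb0 : 0 <= Cb by rewrite addr_ge0 ?mulr_ge0 ?exprn_ge0.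
have CQ0 : 0 < Cb * Q + 1 by rewrite ltr_wpDl // mulr_ge0.
have B20 : 0 < 2 * B + 1 by rewrite ltr_wpDl // mulr_ge0.
(* The first entry bounds the paraboloid's share of the error by [t], the second bounds the gradient
   loss on [J] by [e / 4]. *)
pose h := Num.min (t / (Cb * Q + 1)) (e / 4 / (2 * B + 1)).
have e4 : 0 < e / 4 by rewrite divr_gt0.
have h0 : 0 < h by rewrite lt_min (divr_gt0 t0 CQ0) (divr_gt0 e4 B20).
have hQ : h * (Cb * Q) <= t.
  have : h <= t / (Cb * Q + 1) by rewrite ge_min lexx.
  rewrite ler_pdivlMr // => hh; apply: le_trans hh.
  by rewrite ler_pM2l // lerDl.
have hB : h * (2 * B) <= e / 4.
  have : h <= e / 4 / (2 * B + 1) by rewrite ge_min lexx orbT.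
  rewrite (ler_pdivlMr _ _ B20) => hh; apply: le_trans hh.
  by rewrite ler_pM2l // lerDl.
(* The entries give in turn [s * Q <= t], [s < e / 4], and h |x - y|^2 <= s < h eps^2, that is |x -
   y| < eps. *)
pose d := Num.min (t / (Q + 1)) (Num.min (e / 4) (h * eps ^+ 2)).
have Q1 : 0 < Q + 1 by rewrite ltr_wpDl.
have d0 : 0 < d by rewrite !lt_min (divr_gt0 t0 Q1) e4 mulr_gt0 ?exprn_gt0.
have Ca0 : 0 <= 2 * C / a0 by rewrite divr_ge0 ?mulr_ge0 // ltW.
have Ca1 : 0 < 2 * C / a0 + 1 by rewrite ltr_wpDl.
exists d, (t / (2 * C / a0 + 1)); split => //; first by rewrite divr_gt0.
move=> lam m lam0 laml lm yd; rewrite ltNge; apply/negP => y'e.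
have [_ [sub _]] := sv _ lam0.
have um x : v lam x <= m / lam by rewrite ler_pdivlMr // mulrC.
have hl0 : 0 < h / lam by rewrite divr_gt0.
have [x xy est] := nonlocal_estimate _ _ _ _ _ _ _ B (m / lam) (h / lam) y
  apos B0 betaB wi sub um hl0.
set s := m - lam * v lam y in yd.
have sE : lam * (m / lam - v lam y) = s by rewrite /s; field; rewrite gt_eqF.
have s0 : 0 <= s by rewrite subr_ge0.
move: yd; rewrite !lt_min => /and3P[sd1 sd2 sd3].
have rho : enorm (x - y) < eps.
  rewrite -(@ltr_pXn2r _ 2) ?nnegrE ?enorm_ge0 ?(ltW eps0) // -(ltr_pM2l h0).
  apply: le_lt_trans sd3; rewrite -sE.
  have -> : h * enorm (x - y) ^+ 2 = lam * (h / lam * enorm (x - y) ^+ 2).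
    by field; rewrite gt_eqF.
  by rewrite ler_pM2l.
have rho0 := enorm_ge0 (x - y).
have hrB : h * (enorm (x - y) * B) <= h * B.
  by rewrite ler_pM2l // ler_piMl // (le_trans (ltW rho)).
have cE : lam * (2 * (h / lam * enorm (x - y) * B)) = 2 * (h * (enorm (x - y) * B)).
  by field; rewrite gt_eqF.
have bE : lam * (h / lam * B ^+ 2) = h * B ^+ 2 by field; rewrite gt_eqF.
have c0 : 0 <= e / 4 / lam by rewrite !divr_ge0 // ltW.
have := est J (e / 4 / lam) k mJ c0 kJ.
(* Of the gap [e] at [y'], equicontinuity, the gap [s] and the gradient term each consume at most
   [e / 4]. *)
have cJ z : J z -> e / 4 / lam <= m / lam - v lam (x + beta z) -
    (m / lam - v lam y) - 2 * (h / lam * enorm (x - y) * B).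
  move=> /Jz[kz kzeps]; rewrite -(ler_pM2l lam0) 2!mulrBr.
  rewrite sE cE mulrBr.
  have -> : lam * (m / lam) = m by field; rewrite gt_eqF.
  have -> : lam * (e / 4 / lam) = e / 4 by field; rewrite gt_eqF.
  have [_ [_ [_ [pv _]]]] := sv _ lam0.
  have := Hr lam (x + beta z) (y' + intvec R kz) lam0; rewrite pv => Hxz.
  have {}Hxz : lam * v lam (x + beta z) - lam * v lam y' <= e / 4.
    apply: Hxz; apply: lt_le_trans eps2.
    have -> : x + beta z - (y' + intvec R kz) =
        (x - y) + (y + beta z - y' - intvec R kz).
      by rewrite !addrA subrK opprD addrA.
    by apply: le_lt_trans (ler_enormD _ _) _; rewrite ltrD.
  by lra.
move=> /(_ cJ); rewrite -/Q => {}est.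
have fv : (f x - lam * v lam x) / a x <= 2 * C / a0.
  have : `|f x - lam * v lam x| <= 2 * C.
    apply: le_trans (ler_normB _ _) _.
    by have := fC x; have := resolvent_bounded _ x lam0; lra.
  move=> fvC; apply: le_trans (ler_norm _) _.
  by rewrite normrM normfV (gtr0_norm (apos x)) ler_pM ?invr_ge0 ?(ltW (apos x)) // lef_pV2 ?posrE.
have {}est : e / 4 * k <= (s + h * Cb) * Q + lam * (2 * C / a0).
  have -> : e / 4 * k = lam * (e / 4 / lam * k) by field; rewrite gt_eqF.
  apply: (@le_trans _ _ (lam * ((m / lam - v lam y + 2 * (h / lam * enorm (x - y) * B) +
      h / lam * B ^+ 2) * Q + 2 * C / a0))).
    by rewrite ler_pM2l //; apply: le_trans est _; rewrite lerD2l.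
  rewrite mulrDr mulrA 2!(mulrDr lam) sE cE bE lerD2r ler_wpM2r //.
  by rewrite /Cb; lra.
have lamC : lam * (2 * C / a0) <= t.
  move: laml; rewrite ltr_pdivlMr // => /ltW ll; apply: le_trans ll.
  by rewrite ler_pM2l // lerDl.
have sQ : s * Q <= t.
  move: sd1; rewrite ltr_pdivlMr // => /ltW ss; apply: le_trans ss.
  by rewrite ler_wpM2l // lerDl.
move: est; rewrite mulrDl -(mulrA h).
have -> : e / 4 * k = 4 * t by rewrite /t; field.
by lra.
Qed.

Context (cB : condB mu beta).

Let linked_inT y y' : inT y -> inT y' -> linked y y'.
Proof.
move=> yT y'T; have [k [pts [_ p0 pk _ jump]]] := cB _ _ yT y'T.
suff H i : (i <= k.-1)%N -> linked y (pts i) by rewrite -pk; exact: H.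
elim: i => [_|i IH ik]; first by rewrite p0.
apply: linked_trans (IH (ltnW ik)) _; apply: linked_jump => eps /(jump _ ik)[J [mJ _ J0 HJ]].
by exists J.
Qed.

(** The thresholds of [linked] depend on the pair of points; compactness of the product of two
    cubes, in near-covering form along [lam] tending to 0 from the right, makes them uniform. *)
Lemma resolvent_osc (e : R) : 0 < e ->
  exists2 l0, 0 < l0 & forall lam x y, 0 < lam -> lam < l0 ->
    lam * v lam x - lam * v lam y < e.
Proof.
move=> e0; have e2 : 0 < e / 2 by rewrite divr_gt0.
pose T := [set y : 'rV[R]_N | inT y].
have /compact_near_coveringP cT : compact (T `*` T).
  by apply: compact_setX; exact: compact_box.
(* Taking [p.1] to be a maximum point of [v lam] makes [lam * v lam p.1] the upper bound [m] that
   [linked] asks for. *)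
pose P lam (p : 'rV[R]_N * 'rV[R]_N) := 0 < lam ->
  (forall x, v lam x <= v lam p.1) -> lam * v lam p.1 - lam * v lam p.2 < e.
have [|l0 /= l00 H] := cT R (0 : R)^'+ P _ _.
  move=> [x y] [/= xT yT].
  have [d [l0 [d0 l00 H]]] := linked_inT _ _ xT yT _ e2.
  have d2 : 0 < d / 2 by rewrite divr_gt0.
  have [r r0 Hr] := resolvent_equicontinuous _ d2.
  have [r' r'0 Hr'] := resolvent_equicontinuous _ e2.
  (* Replacing [p] by [x] costs [d / 2], within the tolerance [d]; replacing [y] by [q] costs the
     other half of [e]. *)
  exists ([set p : 'rV[R]_N * 'rV[R]_N | enorm (p.1 - x) < r /\ enorm (p.2 - y) < r'],
          [set lam | lam < l0]) => /=.
    split; last exact: nbhs_right_lt.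
    exists ([set p | enorm (p - x) < r], [set q | enorm (q - y) < r']) => /=.
      by split; exact: near_enorm.
    by move=> [p q] [].
  move=> [[p q] lam] /= [[px qy] laml] lam0 /= vmax.
  have vp := Hr _ _ _ lam0 px.
  have := Hr' _ y q lam0; rewrite enormB => /(_ qy) vq.
  have lmax z : lam * v lam z <= lam * v lam p by rewrite ler_pM2l.
  have pd : lam * v lam p - lam * v lam x < d by lra.
  by have := H lam _ lam0 laml lmax pd; lra.
exists l0 => // lam x y lam0 laml.
have [_ [[us [pv _]] _]] := sv _ lam0.
have [x' x'T xmax] := usc_zperiodic_max _ us pv.
have [k ykT] := translate_inT y.
have := H lam _ lam0 (x', y + intvec R k) (conj x'T ykT) lam0 xmax.
rewrite /ball /= sub0r normrN gtr0_norm // pv => /(_ laml).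
have : lam * v lam x <= lam * v lam x' by rewrite ler_pM2l.
lra.
Qed.

End Ergodic.

(** * The ergodic constant and its characterization *)

Lemma affine_le_const {R : realType} (r f X d del : R) :
  r - f - X <= 0 -> d - r <= del -> d - f - X <= del.
Proof. by lra. Qed.

Lemma const_le_affine {R : realType} (r f X d del : R) :
  0 <= r - f - X -> - del <= d - r -> - del <= d - f - X.
Proof. by lra. Qed.

Theorem theorem3p1 (R : realType) (N M : nat) (withgrad : bool)
  (beta : 'rV[R]_M -> 'rV[R]_N) (a : 'rV[R]_N -> R)
  (mu : {measure set (borelRV R M) -> \bar R})
  (f0 : 'rV[R]_N -> R) (v : R -> 'rV[R]_N -> R)
  (B1 a0 L1 th1 L2 th2 : R) :
  (1 <= M)%N -> (M <= N)%N ->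
  (* beta *)
  continuous beta ->
  (forall (c : R) z, 0 < c -> beta (c *: z) = c *: beta z) ->
  (forall z, enorm (beta z) <= B1 * enorm z) ->
  (* a *)
  continuous a -> zperiodic a -> 0 < a0 -> (forall y, a0 <= a y) ->
  0 < th1 -> th1 <= 1 ->
  (forall y y', `|a y - a y'| <= L1 * powR (enorm (y - y')) th1) ->
  (* dq_0 *)
  radon mu -> condB mu beta ->
  moment_cond (if withgrad then 2%N else 1%N) mu ->
  (* f0 *)
  zperiodic f0 -> 0 < L2 -> 0 < th2 -> th2 <= 1 ->
  (forall y y', `|f0 y - f0 y'| <= L2 * powR (enorm (y - y')) th2) ->
  (* v_lambda *)
  (forall lam : R, 0 < lam ->
     vsol withgrad mu beta a (fun y r => lam * r - f0 y) 0 (v lam)) ->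
  exists d : R,
    [/\ (forall e : R, 0 < e -> exists l0 : R, 0 < l0 /\
           forall lam : R, 0 < lam -> lam < l0 ->
             forall y, `|lam * v lam y - d| < e),
        (forall d' : R, (forall e : R, 0 < e -> exists l0 : R, 0 < l0 /\
           forall lam : R, 0 < lam -> lam < l0 ->
             forall y, `|lam * v lam y - d'| < e) -> d' = d),
        ergodic_prop withgrad mu beta a f0 d
      & forall d' : R, ergodic_prop withgrad mu beta a f0 d' -> d' = d].
Proof.
move=> M1 MN _ _ betaB _ pa a00 a0a th10 _ aH _ cB mom pf _ th20 _ fH sv.
have ua := hoelder_ucont _ _ _ th10 aH.
have uf := hoelder_ucont _ _ _ th20 fH.
have apos y : 0 < a y by exact: lt_le_trans (a0a y).
have [C fC] := ucont_zperiodic_bounded _ uf pf.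
have wi := integrable_levy_weight _ _ mom.
have betaB' z : enorm (beta z) <= `|B1| * enorm z.
  by apply: (le_trans (betaB z)); rewrite ler_wpM2r ?enorm_ge0 ?ler_norm.
have bnd lam y := resolvent_bounded _ _ _ _ _ _ _ _ a00 a0a fC sv lam y.
have osc := resolvent_osc _ _ _ _ _ _ _ _ _ a00 a0a ua uf (normr_ge0 B1) betaB' wi fC sv cB.
have cmp G1 G2 c1 c2 U V p q :=
  comparison_const withgrad mu beta a G1 G2 c1 c2 U V f0 a0 p q a00 a0a ua uf pf.
have subv lam (l0 : 0 < lam) := (sv _ l0).2.1.
have supv lam (l0 : 0 < lam) := (sv _ l0).2.2.
(* Comparison between different [lam] puts every lower bound of one [lam * v lam] below every upper
   bound of another, so [sup E] lies between the minimum and the maximum of each of them. *)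
pose E := [set t | exists2 lam, 0 < lam & forall y, t <= lam * v lam y].
have E_le t lam q : E t -> 0 < lam -> (forall y, lam * v lam y <= q) -> t <= q.
  move=> [lam' l'0 tE] l0 qE.
  by apply: (cmp _ _ _ _ _ _ _ _ (subv _ l'0) (supv _ l0)) => y; rewrite subr0 lerD2r.
have E0 : E !=set0.
  exists (- C), 1 => // y.
  by have := bnd 1 y ltr01; rewrite ler_norml => /andP[].
have Eub : has_ubound E.
  exists C => t Et; apply: (E_le t 1) => // y.
  by have := bnd 1 y ltr01; rewrite ler_norml => /andP[].
pose d := sup E.
have d_le lam q : 0 < lam -> (forall y, lam * v lam y <= q) -> d <= q.
  by move=> l0 qE; apply: sup_le_ub => // t Et; exact: E_le l0 qE.
have le_d lam t : 0 < lam -> (forall y, t <= lam * v lam y) -> t <= d.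
  by move=> l0 tE; apply: sup_upper_bound; [split|exists lam].
have cvg_d (e : R) : 0 < e -> exists l0 : R, 0 < l0 /\
    forall lam : R, 0 < lam -> lam < l0 -> forall y, `|lam * v lam y - d| < e.
  move=> e0; have e2 : 0 < e / 2 by rewrite divr_gt0.
  have [l0 l00 H] := osc _ e2; exists l0; split => // lam lam0 laml y.
  (* By the oscillation bound this value is a lower bound of [lam * v lam], and the one in [h2] an
     upper bound. *)
  have h1 : lam * v lam y - e / 2 <= d.
    by apply: (le_d lam) => // x; have := H lam y x lam0 laml; lra.
  have h2 : d <= lam * v lam y + e / 2.
    by apply: (d_le lam) => // x; have := H lam x y lam0 laml; lra.
  by rewrite ltr_norml; lra.
exists d; split => //.
- move=> d' H; apply/eqP; rewrite -subr_eq0 -normr_le0; apply/ler_addgt0Pr => e e0.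
  have e2 : 0 < e / 2 by rewrite divr_gt0.
  have [l1 [l10 H1]] := H _ e2; have [l2 [l20 H2]] := cvg_d _ e2.
  pose lam := Num.min l1 l2 / 2.
  have m0 : 0 < Num.min l1 l2 by rewrite lt_min l10.
  have lam0 : 0 < lam by rewrite divr_gt0.
  have lm : lam < Num.min l1 l2 by rewrite /lam; lra.
  move: lm; rewrite lt_min => /andP[lm1 lm2].
  have := H1 _ lam0 lm1 0; have := H2 _ lam0 lm2 0.
  by rewrite !ltr_norml add0r ler_norml; lra.
- move=> e e0; have [l0 [l00 H]] := cvg_d _ e0.
  have lam0 : 0 < l0 / 2 by rewrite divr_gt0.
  have {}H := H _ lam0 (ltac:(lra)).
  (* One resolvent solution provides both correctors: exchanging [lam * v lam] for [d] changes the
     equation by less than [e]. *)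
  split; exists (v (l0 / 2)).
  + have [us [pv sv']] := subv _ lam0; split=> //; split=> // yh phi Cphi phimax phiE.
    have [ui ule] := sv' yh phi Cphi phimax phiE; split=> //.
    apply: affine_le_const ule _.
    by have := H yh; rewrite ltr_norml; lra.
  + have [ls [pv sv']] := supv _ lam0; split=> //; split=> // yh phi Cphi phimin phiE.
    have [ui ule] := sv' yh phi Cphi phimin phiE; split=> //.
    apply: const_le_affine ule _.
    by have := H yh; rewrite ltr_norml; lra.
(* Correctors for [d'] are compared with [v lam] for small [lam]: the subsolution gives
   [d' <= d + e], the supersolution [d <= d' + e]. *)
- move=> d' Hd'; apply/le_anti/andP; split; apply/ler_addgt0Pr => e e0.
    have e2 : 0 < e / 2 by rewrite divr_gt0.
    have [[u su] _] := Hd' _ e2; have [l0 [l00 H]] := cvg_d _ e2.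
    have lam0 : 0 < l0 / 2 by rewrite divr_gt0.
    have {}H := H _ lam0 (ltac:(lra)).
    have : d' - e / 2 <= d + e / 2.
      apply: (cmp _ _ _ _ _ _ _ _ su (supv _ lam0)) => y; first by rewrite addrAC.
      by rewrite subr0 lerD2r; have := H y; rewrite ltr_norml; lra.
    by lra.
  have e2 : 0 < e / 2 by rewrite divr_gt0.
  have [_ [u su]] := Hd' _ e2; have [l0 [l00 H]] := cvg_d _ e2.
  have lam0 : 0 < l0 / 2 by rewrite divr_gt0.
  have {}H := H _ lam0 (ltac:(lra)).
  have : d - e / 2 <= d' + e / 2.
    apply: (cmp _ _ _ _ _ _ _ _ (subv _ lam0) su) => y; last by rewrite opprK addrAC.
    by rewrite subr0 lerD2r; have := H y; rewrite ltr_norml; lra.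
  by lra.
Qed.
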